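(* Let $\mathbb X,\mathbb Y$ be finite-dimensional Hilbert spaces and $b\in\mathbb Y$. Let $f:\mathbb X\to\mathbb R\cup\{+\infty\}$ be proper, closed and convex, let $A:\mathbb X\to\mathbb Y$ be a surjective linear operator, let $\mathcal E=\{x\in\mathbb X:Ax=b\}$ and $f_{\mathcal E}=f+\delta_{\mathcal E}$, and assume $\mathcal F:=\mathcal E\cap\operatorname{dom} f\neq\emptyset$. For $x\in\mathcal F$ consider the following conditions: (1) Subdifferential sum rule: $\partial f_{\mathcal E}(x)=\partial f(x)+A^*\mathbb Y$. (2) Restricted subdifferential sum rule: $\partial f_{\mathcal E}(x)=\partial f(x)+A^*\mathbb Y$ and $\partial^\infty f_{\mathcal E}(x)=\partial^\infty f(x)+A^*\mathbb Y$. (3) Epigraphical strong conical hull intersection property: $\mathcal N_{\operatorname{epi} f_{\mathcal E}}(x,f(x))=\mathcal N_{\operatorname{epi} f}(x,f(x))+\mathcal N_{\mathcal E\times\mathbb R}(x,f(x))$. (4) Epigraphical transversality: $\mathcal N_{\operatorname{epi} f}(x,f(x))\cap\mathcal N_{\mathcal E\times\mathbb R}(x,f(x))=\{0\}$, or equivalently $\mathcal T_{\operatorname{epi} f}(x,f(x))+\mathcal T_{\mathcal E\times\mathbb R}(x,f(x))=\mathbb X\times\mathbb R$. (5) Horizon qualification condition: $\partial^\infty f(x)\cap A^*\mathbb Y=\{0\}$. (6) Robinson constraint qualification: $\mathcal T_f(x)+\ker A=\mathbb X$, equivalently $A\,\mathcal T_f(x)=\mathbb Y$. (7) Robinson constraint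 nondegeneracy: $\operatorname{lin}\mathcal T_f(x)+\ker A=\mathbb X$, equivalently $A(\operatorname{lin}\mathcal T_f(x))=\mathbb Y$. Then $(7)\Rightarrow(6)$, $(4)\Leftrightarrow(5)\Leftrightarrow(6)$, $(4)\Rightarrow(3)$, $(2)\Leftrightarrow(3)$, and $(2)\Rightarrow(1)$.
   Context: $\delta_{\mathcal E}$ is the indicator function of $\mathcal E$. $A^*\mathbb Y$ is the range of the adjoint $A^*$. $\operatorname{epi} h=\{(x,\tau)\in\mathbb X\times\mathbb R: x\in\operatorname{dom} h,\ \tau\ge h(x)\}$. $\mathcal N_S$ and $\mathcal T_S$ denote the normal and tangent cones (of convex analysis, for the convex sets here). $\partial h$ is the subdifferential and $\partial^\infty h$ the horizon subdifferential in the sense of Rockafellar–Wets: $v\in\partial^\infty h(x)$ iff there are $x_k\to x$ with $h(x_k)\to h(x)$, regular subgradients $v_k\in\widehat\partial h(x_k)$ and $t_k\downarrow 0$ with $t_kv_k\to v$, or $v=0$. $\mathcal T_f(x):=\{v\in\mathbb X: (v,h)\in\mathcal T_{\operatorname{epi} f}(x,f(x))\text{ for some }h\in\mathbb R\}$. $\operatorname{lin}(S)$ is the largest linear subspace contained in $S$. *)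

(* Defs.v *)
From HB Require Import structures.
From mathcomp Require Import all_boot all_order all_algebra.
From mathcomp Require Import ring lra.
From mathcomp Require Import all_classical all_reals all_analysis.

Set Implicit Arguments.
Unset Strict Implicit.
Unset Printing Implicit Defensive.

Import Order.TTheory GRing.Theory Num.Theory.
Import numFieldNormedType.Exports.

Local Open Scope classical_set_scope.
Local Open Scope ring_scope.

(* Real Hilbert spaces: finite dimension comes from [Vector], and makes
   completeness automatic. *)
HB.mixin Record isHilbert (R : realType) V
    of NormedModule R V & Vector R V := {
  inner : V -> V -> R ;
  innerC : forall u v, inner u v = inner v u ;
  innerDl : forall u v w, inner (u + v) w = inner u w + inner v w ;
  innerZl : forall (a : R) u v, inner (a *: u) v = a * inner u v ;
  inner_norm : forall u, inner u u = `|u| ^+ 2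
}.

#[short(type="finHilbertType")]
HB.structure Definition FinHilbert (R : realType) :=
  { V of NormedModule R V & Vector R V & isHilbert R V }.

Section Adjoint.
Context {R : realType} {X Y : finHilbertType R}.

Lemma innerDr (u v w : X) : inner w (u + v) = inner w u + inner w v.
Proof. by rewrite innerC innerDl !(innerC w). Qed.

Lemma innerZr (a : R) (u v : X) : inner v (a *: u) = a * inner v u.
Proof. by rewrite innerC innerZl innerC. Qed.

Lemma riesz (phi : {linear X -> R^o}) :
  exists v : X, forall u, phi u = inner u v.
Proof.
pose g (v u : X) : R^o := inner u v.
have glin v : linear (g v) by move=> a x y; rewrite /g innerDl innerZl.
pose gL v : {linear X -> R^o} :=
  HB.pack (g v) (GRing.isLinear.Build _ _ _ _ (g v) (glin v)).
pose h v : 'Hom(X, R^o) := linfun (gL v).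
have hE v u : h v u = inner u v by rewrite lfunE.
have hlin : linear h.
  move=> a v w; apply/lfunP => u.
  by rewrite add_lfunE scale_lfunE !hE innerDr innerZr.
pose hL : {linear X -> 'Hom(X, R^o)} :=
  HB.pack h (GRing.isLinear.Build _ _ _ _ h hlin).
pose H := linfun hL.
have kerH : lker H == 0%VS.
  apply/lker0P => v w; rewrite !lfunE /= => hvw.
  apply/eqP; rewrite -subr_eq0 -normr_eq0 -sqrf_eq0 -inner_norm.
  have := congr1 (fun k : 'Hom(X, R^o) => k (v - w)) hvw.
  rewrite /= !hE => e.
  by rewrite -[X in inner _ (_ + X)]scaleN1r innerDr innerZr e mulN1r subrr.
have imH : limg H = fullv.
  apply/eqP; rewrite eqEdim subvf limg_dim_eq; last first.
    by move: kerH => /eqP ->; rewrite capv0.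
  by rewrite !dimvf /dim /= muln1.
have : linfun phi \in limg H by rewrite imH memvf.
move=> /memv_imgP[v _ e]; exists v => u.
by rewrite -hE -[phi u](lfunE phi) e lfunE.
Qed.

Definition adjoint (A : X -> Y) (y : Y) : X :=
  xget 0 [set v | forall u, inner (A u) y = inner u v].

Lemma adjointE (A : {linear X -> Y}) (u : X) (y : Y) :
  inner (A u) y = inner u (adjoint A y).
Proof.
have flin : linear (fun u => inner (A u) y : R^o).
  by move=> a v w; rewrite linearP innerDl innerZl.
pose phi : {linear X -> R^o} :=
  HB.pack (fun u => inner (A u) y : R^o)
    (GRing.isLinear.Build _ _ _ _ (fun u => inner (A u) y : R^o) flin).
have [v hv] := riesz phi.
by rewrite /adjoint; case: xgetP => [w _ -> //|/(_ v)]; case => z; exact: hv.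
Qed.

End Adjoint.

Section ConvexAnalysis.
Context {R : realType} {X : finHilbertType R}.
Implicit Types (h : X -> \bar R) (x : X).

Definition dom h : set X := [set x | (h x < +oo)%E].

Definition epi h : set (X * R^o) :=
  [set p | dom h p.1 /\ (h p.1 <= (p.2)%:E)%E].

Definition proper_fun h := (forall x, h x != -oo%E) /\ dom h !=set0.

Definition closed_fun h := closed (epi h).

Definition convex_fun h := forall (x y : X) (t : R), 0 <= t <= 1 ->
  (h (t *: x + (1 - t) *: y)%R <= t%:E * h x + (1 - t)%:E * h y)%E.

Definition indicator (E : set X) (x : X) : \bar R :=
  if x \in E then 0%E else +oo%E.

(* The tangent cone of convex analysis, for a convex set S and z in S. *)
Definition tangent_cone (V : normedModType R) (S : set V) (z : V) : set V :=
  closure [set w | exists t y, [/\ 0 <= t, S y & w = t *: (y - z)]].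

(* Normal cone of convex analysis in the product Hilbert space X * R, whose
   inner product is <(v, s), (u, r)> = <v, u> + s r (the library norm on the
   product is the sup norm, which has the same topology). *)
Definition normal_cone (S : set (X * R^o)) (z : X * R^o) : set (X * R^o) :=
  [set w | S z /\
    forall p, S p -> inner w.1 (p.1 - z.1) + w.2 * (p.2 - z.2) <= 0].

(* Subdifferential of convex analysis; see subdiff_limiting for its agreement
   with the limiting subdifferential of variational analysis. *)
Definition subdiff h x : set X :=
  [set v | h x \is a fin_num /\
    forall y, (h x + (inner v (y - x)%R)%:E <= h y)%E].

Definition regular_subdiff h x : set X :=
  [set v | h x \is a fin_num /\ forall e : R, 0 < e ->
    \forall y \near x, (h x + (inner v (y - x) - e * `|y - x|)%R%:E <= h y)%E].

(* Horizon subdifferential of Rockafellar and Wets. *)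
Definition horizon_subdiff h x : set X :=
  [set v | v = 0 \/
    exists (x_ v_ : nat -> X) (t_ : nat -> R),
      [/\ x_ @ \oo --> x /\ h \o x_ @ \oo --> h x,
          forall k, regular_subdiff h (x_ k) (v_ k),
          forall k, 0 < t_ k,
          t_ @ \oo --> (0 : R)
        & (fun k => t_ k *: v_ k) @ \oo --> v]].

Definition tangent_dirs h x : set X :=
  [set v | exists r : R, tangent_cone (epi h) (x, fine (h x)) (v, r)].

(* Union of the linear subspaces contained in S: the largest such subspace
   whenever there is one, in particular for convex cones (lin_largest). *)
Definition lin (S : set X) : set X :=
  [set v | exists W : {vspace X}, [set` W] `<=` S /\ v \in W].

Lemma lin_largest (S : set X) : S 0 ->
  (forall u v, S u -> S v -> S (u + v)) ->
  exists W : {vspace X}, [/\ lin S = [set` W], [set` W] `<=` S &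
    forall U : {vspace X}, [set` U] `<=` S -> (U <= W)%VS].
Proof.
move=> S0 SD.
pose P n := `[< exists2 W : {vspace X}, [set` W] `<=` S & \dim W = n >].
have P0 : exists n, P n.
  exists 0%N; apply/asboolP; exists 0%VS; last exact: dimv0.
  by move=> v /=; rewrite memv0 => /eqP ->.
have Pb n : P n -> (n <= \dim {: X})%N.
  by move=> /asboolP[W _ <-]; exact/dimvS/subvf.
case: (ex_maxnP P0 Pb) => m /asboolP[W WS dW] mmax.
have Wmax (U : {vspace X}) : [set` U] `<=` S -> (U <= W)%VS.
  move=> US.
  have UWS : [set` (U + W)%VS] `<=` S.
    by move=> v /= /memv_addP[u uU [w wW ->]]; apply: SD; [exact: US|exact: WS].
  have /mmax : P (\dim (U + W)%VS) by apply/asboolP; exists (U + W)%VS.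
  rewrite -dW => le.
  have /eqP -> : W == (U + W)%VS by rewrite eqEdim addvSr le.
  exact: addvSl.
exists W; split => //; apply/seteqP; split => v /=.
  by move=> [U [US vU]]; exact: (subvP (Wmax _ US)).
by move=> vW; exists W.
Qed.

Lemma inner_cvg (u_ v_ : nat -> X) (u v : X) :
  u_ @ \oo --> u -> v_ @ \oo --> v ->
  (fun k => inner (u_ k) (v_ k)) @ \oo --> inner u v.
Proof.
have pol (a c : X) : inner a c = (`|a + c| ^+ 2 - `|a| ^+ 2 - `|c| ^+ 2) / 2.
  rewrite -!inner_norm innerDl !innerDr (innerC c a).
  by field.
move=> cu cv; rewrite pol; under eq_fun do rewrite pol.
apply: cvgMl; apply: cvgB; first apply: cvgB.
- rewrite expr2; under eq_fun do rewrite expr2.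
  by apply: cvgM; apply: cvg_norm; exact: cvgD.
- rewrite expr2; under eq_fun do rewrite expr2.
  by apply: cvgM; exact: cvg_norm.
- rewrite expr2; under eq_fun do rewrite expr2.
  by apply: cvgM; exact: cvg_norm.
Qed.


Lemma regular_subdiff_convex h x : convex_fun h -> proper_fun h ->
  regular_subdiff h x = subdiff h x.
Proof.
move=> ch [hN _]; apply/seteqP; split => v [fx hv]; split => //; last first.
  move=> e e0; near=> y; apply: le_trans (hv y).
  by rewrite leeD2l// lee_fin gerBl mulr_ge0// ltW.
move=> y; have [->|fy] := eqVneq (h y) +oo%E; first by rewrite leey.
have fiy : h y \is a fin_num by rewrite fin_numE hN fy.
rewrite -(fineK fx) -(fineK fiy) -EFinD lee_fin.
set a := fine (h x); set c := fine (h y).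
apply/ler_addgt0Pr => e e0.
have e1 : 0 < e / (`|y - x| + 1) by rewrite divr_gt0// ltr_wpDl.
have := hv _ e1 => /nbhs_ballP[d /= d0 hd].
pose t : R := Num.min 1 (d / (`|y - x| + 1) / 2).
have n0 : 0 < `|y - x| + 1 by rewrite ltr_wpDl.
have t0 : 0 < t by rewrite lt_min ltr01 !divr_gt0.
have t1 : t <= 1 by rewrite ge_min lexx.
have td : t * `|y - x| < d.
  have : t <= d / (`|y - x| + 1) / 2 by rewrite ge_min lexx orbT.
  rewrite -mulrA -invfM ler_pdivlMr ?mulr_gt0// => h1.
  have : 0 <= `|y - x| by [].
  by nra.
have zE : t *: y + (1 - t) *: x = x + t *: (y - x).
  by rewrite scalerBl scale1r scalerBr addrCA addrA.
have /hd : ball x d (x + t *: (y - x)).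
  rewrite -ball_normE /ball_ /= opprD addrA subrr add0r normrN normrZ.
  by rewrite gtr0_norm.
have /(ch y x) : 0 <= t <= 1 by rewrite ltW.
rewrite zE => /[swap] /= h1 h2; have := le_trans h1 h2.
rewrite -(fineK fx) -(fineK fiy) -/a -/c [x + _]addrC addrK.
rewrite -!EFinM -!EFinD lee_fin innerZr normrZ gtr0_norm// => h3.
have : a + inner v (y - x) - e / (`|y - x| + 1) * `|y - x| <= c.
  rewrite -(ler_pM2l t0); lra.
have : e / (`|y - x| + 1) * `|y - x| <= e.
  by rewrite mulrAC ler_pdivrMr// ler_pM2l// lerDl.
lra.
Unshelve. all: by end_near.
Qed.

Lemma subdiff_limiting h x : convex_fun h -> proper_fun h -> dom h x ->
  subdiff h x = [set v | exists x_ v_ : nat -> X,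
    [/\ x_ @ \oo --> x, h \o x_ @ \oo --> h x,
        forall k, regular_subdiff h (x_ k) (v_ k) & v_ @ \oo --> v]].
Proof.
move=> ch ph dx.
have fx : h x \is a fin_num by rewrite fin_numE ph.1/= lt_eqF.
apply/seteqP; split => v /=.
  move=> hv; exists (fun=> x), (fun=> v); split; try exact: cvg_cst.
  by move=> _; rewrite regular_subdiff_convex.
move=> [x_ [v_ [cx ch_ hv cv]]]; split=> // y.
have [->|fy] := eqVneq (h y) +oo%E; first by rewrite leey.
have fiy : h y \is a fin_num by rewrite fin_numE ph.1 fy.
have chf : (fun k => fine (h (x_ k))) @ \oo --> fine (h x).
  by apply: fine_cvg; rewrite fineK.
have ci : (fun k => inner (v_ k) (y - x_ k)) @ \oo --> inner v (y - x).
  by apply: inner_cvg => //; apply: cvgB => //; exact: cvg_cst.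
rewrite -(fineK fx) -(fineK fiy) -EFinD lee_fin.
apply: (cvgr_to_le (cvgD chf ci)); near=> k.
have := hv k; rewrite regular_subdiff_convex// => -[fk /(_ y)].
by rewrite /= -(fineK fk) -(fineK fiy) -EFinD lee_fin.
Unshelve. all: by end_near.
Qed.

End ConvexAnalysis.

Section Conditions.
Context {R : realType} {X Y : finHilbertType R}.
Variables (f : X -> \bar R) (A : {linear X -> Y}) (b : Y).

Definition fiber : set X := [set x | A x = b].

Definition feasible : set X := fiber `&` dom f.

Definition restr_fun (x : X) : \bar R := (f x + indicator fiber x)%E.

Definition adjoint_range : set X := range (adjoint A).

Definition lin_kernel : set X := [set x | A x = 0].

(* The cylinder over the fiber in the product X * R. *)
Definition fiberR : set (X * R^o) := fiber `*` setT.

Variable x : X.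

Let z : X * R^o := (x, fine (f x)).

Definition sum_rule :=
  subdiff restr_fun x =
    [set u + w | u in subdiff f x & w in adjoint_range].

Definition restricted_sum_rule :=
  sum_rule /\
  horizon_subdiff restr_fun x =
    [set u + w | u in horizon_subdiff f x & w in adjoint_range].

Definition epi_strong_CHIP :=
  normal_cone (epi restr_fun) z =
    [set u + w | u in normal_cone (epi f) z & w in normal_cone fiberR z].

Definition epi_transversality :=
  normal_cone (epi f) z `&` normal_cone fiberR z = [set 0].

Definition epi_transversality_tangent :=
  [set u + w | u in tangent_cone (epi f) z & w in tangent_cone fiberR z]
    = setT.

Definition horizon_qualification :=
  horizon_subdiff f x `&` adjoint_range = [set 0].

Definition robinson_CQ :=
  [set u + w | u in tangent_dirs f x & w in lin_kernel] = setT.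

Definition robinson_CQ_image := A @` tangent_dirs f x = setT.

Definition robinson_nondegeneracy :=
  [set u + w | u in lin (tangent_dirs f x) & w in lin_kernel] = setT.

Definition robinson_nondegeneracy_image :=
  A @` lin (tangent_dirs f x) = setT.

End Conditions.

(* Main.v *)
From HB Require Import structures.
Require Import Defs.
From mathcomp Require Import all_boot all_order all_algebra.
From mathcomp Require Import ring lra.
From mathcomp Require Import all_classical all_reals all_analysis.

Set Implicit Arguments.
Unset Strict Implicit.
Unset Printing Implicit Defensive.

Import Order.TTheory GRing.Theory Num.Theory.
Import numFieldNormedType.Exports.
Import VectorInternalTheory.

Local Open Scope classical_set_scope.
Local Open Scope ring_scope.

(** Everything is read off from the normal cone N of epi f at (x, f x).  Its
elements (v, s) have s <= 0; the slice s = -1 is the subdifferential and the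
slice s = 0 is the normal cone of dom f at x, while the normal cone of the
cylinder over the fiber is (range of the adjoint of A) x {0}.  The point that
needs analysis is that for a proper closed convex function the horizon
subdifferential, a set of limits of scaled subgradients at nearby points, is
exactly the slice s = 0 ([horizon_subdiff_normal_dom]).  A limit of scaled
subgradients is clearly normal to the domain.  Conversely, if v is normal to
dom f at x, minimise eps f(y) + |y - x - v|^2 / 2: optimality at the minimiser
y makes (v - (y - x)) / eps a subgradient at y, comparison with x gives
f y <= f x and |y - x|^2 = O(eps), and eps -> 0 recovers v
([proximal_subgradient]).

With these slices (4) <-> (5) is immediate, and (2) <-> (3) holds because a
cone contained in {s <= 0} is determined by its slices at s = -1 and s = 0,
applied to f and to its restriction to the fiber.

The remaining implications rest on one separation theorem: in finite dimension
a convex cone other than the whole space, closed or not, lies in a closed half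
space ([cone_separation]).
- (5) -> (6): were the cone generated by (dom f - x) + ker A proper, a
  separating vector would be a nonzero element of the horizon subdifferential
  orthogonal to ker A, hence in the range of the adjoint.
- (5) -> (3): a normal (v, s) to the epigraph of the restricted function says
  that v.(y - x) + s (r - f x) <= 0 on the points (y, r) of epi f with A y = b.
  Separation in Y x R, applied to the cone generated by the pairs
  (A y - b, value of that form), yields a Lagrange multiplier.  The
  qualification (5) excludes a multiplier with zero weight on the value, so
  dividing by the weight moves a vector of the range of the adjoint from
  (v, s) into N.
The converse (6) -> (5) pairs a vector of the horizon subdifferential in the
range of the adjoint with itself, and the tangent form of (4) is (6) lifted to
the product with R, because the tangent cone of the cylinder is ker A x R. *)

(** * Separation of a convex cone from the whole space *)

Definition convex_cone (R : realType) (V : lmodType R) (D : set V) :=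
  [/\ D 0, forall u v, D u -> D v -> D (u + v)
    & forall (t : R) u, 0 <= t -> D u -> D (t *: u)].

Section RowVectors.
Context {R : realType} {n : nat}.
Implicit Types (D : set 'rV[R]_n) (p d w : 'rV[R]_n).

Lemma cone_sum D (I : finType) (F : I -> 'rV[R]_n) : convex_cone D ->
  (forall i, D (F i)) -> D (\sum_i F i).
Proof. by move=> [D0 DD _] DF; elim/big_ind: _. Qed.

(** A matrix of maximal rank among those whose rows lie in D has the same row
    space as D: adjoining a further element of D cannot raise the rank. *)
Lemma cone_span_or_annihilator D :
  (exists (m : nat) (M : 'M[R]_(m, n)),
    (forall i, D (row i M)) /\ row_full M) \/
  (exists2 w : 'rV[R]_n, w != 0 & forall d, D d -> (d *m w^T) 0 0 = 0).
Proof.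
pose P r := `[< exists (m : nat) (M : 'M[R]_(m, n)),
  (forall i, D (row i M)) /\ \rank M = r >].
have P0 : exists r, P r.
  exists 0%N; apply/asboolP; exists 0%N, (0 : 'M[R]_(0, n)).
  by split; [case|rewrite mxrank0].
have Pb r : P r -> (r <= n)%N.
  by move=> /asboolP[m [M [_ <-]]]; exact: rank_leq_col.
case: (ex_maxnP P0 Pb) => r /asboolP[m [M [DM rM]]] rmax.
have [Mfull|Mnfull] := boolP (row_full M); first by left; exists m, M.
right; have : kermx M^T != 0 by rewrite kermx_eq0 /row_free mxrank_tr.
move=> /rowV0Pn[w /sub_kermxP wM w0]; exists w => // d Dd.
have : P (\rank (col_mx M d)).
  apply/asboolP; exists (m + 1)%N, (col_mx M d); split => // i.
  by case: (split_ordP i) => j ->; rewrite ?rowKu ?rowKd// (ord1 j) row_id.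
move=> /rmax; rewrite -rM => le.
have sM : (M <= col_mx M d)%MS by have := submx_refl (col_mx M d);
  rewrite {1}col_mx_sub => /andP[].
have : (col_mx M d <= M)%MS.
  by rewrite -(mxrank_leqif_sup sM) eqn_leq le mxrankS.
rewrite col_mx_sub => /andP[_ /submxP[c ->]].
by rewrite -mulmxA -[M]trmxK -trmx_mul wM trmx0 mulmx0 mxE.
Qed.

Definition sqdist p (x : 'rV[R]_n) : R := \sum_j (x 0 j - p 0 j) ^+ 2.

Lemma sqdist_continuous p : continuous (sqdist p).
Proof.
apply: continuous_big => [|j _]; first exact: add_continuous.
move=> x; have c : (fun y : 'rV[R]_n => y 0 j - p 0 j) @ x --> x 0 j - p 0 j.
  exact: cvgB (@coord_continuous R 1 n 0 j x) (cvg_cst _).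
exact: (cvgM c c).
Qed.

Lemma coord_le_sqdist p (x : 'rV[R]_n) j : (x 0 j - p 0 j) ^+ 2 <= sqdist p x.
Proof.
by rewrite /sqdist (bigD1 j)//= lerDl sumr_ge0// => i _; exact: sqr_ge0.
Qed.

Lemma nearest_point (S : set 'rV[R]_n) p : closed S -> S !=set0 ->
  exists2 q, S q & forall x, S x -> sqdist p q <= sqdist p x.
Proof.
move=> clS [s Ss].
pose K := S `&` [set x | sqdist p x <= sqdist p s].
have clK : closed K.
  apply: closedI => //; apply: (preimage_closed _ (@closed_le _ _)) => x _.
  exact: sqdist_continuous.
have bK : bounded_set K.
  exists (sqdist p s + 1 + `|p|); split; first exact: num_real.
  move=> B ltB x [_ /= xs].
  have B0 : 0 <= B.
    apply: le_trans (ltW ltB); rewrite !addr_ge0//.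
    by apply: sumr_ge0 => i _; exact: sqr_ge0.
  rewrite [leLHS]mx_normrE; apply/bigmax_leP; split => //= -[i j] _ /=.
  rewrite (ord1 i).
  have h1 : (x 0 j - p 0 j) ^+ 2 <= sqdist p s.
    exact: le_trans (coord_le_sqdist _ _ _) xs.
  have h2 : `|p 0 j| <= `|p|.
    rewrite [leRHS]mx_normrE.
    exact: (le_bigmax _ (fun ij => `|p ij.1 ij.2|) (0, j)).
  have h3 : `|x 0 j - p 0 j| <= sqdist p s + 1.
    move: h1; rewrite -real_normK ?num_real//.
    have : 0 <= `|x 0 j - p 0 j| by [].
    by nra.
  rewrite -[x 0 j](subrK (p 0 j)).
  apply: le_trans (ler_normD _ _) _.
  lra.
have K0 : K !=set0 by exists s; split => /=.
have [q qK qmin] := EVT_min_rV K0 (bounded_closed_compact bK clK)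
  (continuous_subspaceT (@sqdist_continuous p)).
move: qK; rewrite inE => -[Sq qs]; exists q => // x Sx.
have [xs|/ltW sx] := leP (sqdist p x) (sqdist p s).
  by apply: qmin; rewrite inE.
exact: le_trans qs sx.
Qed.

Lemma closure_cone_add D q d : convex_cone D -> closure D q -> D d ->
  closure D (q + d).
Proof.
move=> [_ DD _] Dq Dd.
have cl : closed ((fun x => x + d) @^-1` closure D).
  apply: preimage_closed (closed_closure (A := D)) => x _.
  exact: cvgD cvg_id (cvg_cst _).
have /closure_id := cl => cE.
have : closure D `<=` (fun x => x + d) @^-1` closure D.
  rewrite cE; apply: closureS => x Dx /=.
  by apply: subset_closure; exact: DD.
exact.
Qed.

(** A dense convex cone is everything.  Write e for the sum of the rows of M.
    Density gives d in D close to p - e, and p - d = e + small is then a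
    combination of the rows of M whose coefficients are all close to 1, hence
    nonnegative. *)
Lemma closure_cone_interior D p : convex_cone D ->
  (exists (m : nat) (M : 'M[R]_(m, n)),
    (forall i, D (row i M)) /\ row_full M) ->
  (forall u, closure D u) -> D p.
Proof.
move=> coneD [m [M [DM Mfull]]] clD.
have [D0 DD DZ] := coneD.
pose P := pinvmx M.
have MP d : d *m P *m M = d by rewrite mulmxKpV// submx_full.
have comb (c : 'rV[R]_m) : (forall i, 0 <= c 0 i) -> D (c *m M).
  move=> c0; rewrite mulmx_sum_row; apply: cone_sum => // i.
  exact: DZ.
pose e : 'rV[R]_m := const_mx 1.
pose K := \sum_j \sum_i `|P j i| + 1.
have K0 : 0 < K by rewrite ltr_wpDl// sumr_ge0// => j _; exact: sumr_ge0.
have [d [Dd]] : (D `&` ball (p - e *m M) K^-1) !=set0.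
  by apply: clD; apply: nbhsx_ballx; rewrite invr_gt0.
move=> [_ near_d].
have -> : p = d + (e + (p - d - e *m M) *m P) *m M.
  by rewrite mulmxDl MP [e *m M + _]addrC subrK addrC subrK.
apply: DD => //; apply: comb => i; rewrite !mxE.
have : `|\sum_j (p - d - e *m M) 0 j * P j i| <= 1.
  apply: le_trans (ler_norm_sum _ _ _) _.
  apply: (@le_trans _ _ (\sum_j K^-1 * `|P j i|)).
    apply: ler_sum => j _; rewrite normrM ler_wpM2r//.
    have := near_d 0 j; rewrite -ball_normE /= => /ltW.
    by rewrite !mxE (addrAC (p 0 j)).
  rewrite -mulr_sumr mulrC ler_pdivrMr// mul1r.
  apply: (@le_trans _ _ (\sum_j \sum_i `|P j i|)); last by rewrite lerDl.
  apply: ler_sum => j _; rewrite (bigD1 i)//= lerDl.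
  exact: sumr_ge0.
by rewrite ler_norml => /andP[]; lra.
Qed.

(** If D spans, its closure misses some p, and w is p minus the nearest point q
    of the closure: for d in D the point q + s d stays in the closure, and the
    first-order term in s of its squared distance to p must be nonnegative. *)
Lemma cone_separation_row D u : convex_cone D -> ~ D u ->
  exists2 w : 'rV[R]_n, w != 0 & forall d, D d -> (d *m w^T) 0 0 <= 0.
Proof.
move=> coneD Du; have [D0 DD DZ] := coneD.
case: (cone_span_or_annihilator D) => [spanD|[w w0 wD]]; last first.
  by exists w => // d /wD ->.
have [p clp] : exists p, ~ closure D p.
  apply: contrapT => /forallNP clD; apply: Du.
  by apply: closure_cone_interior => // x; apply: contrapT; exact: clD.
have [|q clq qmin] := nearest_point p (@closed_closure _ D).
  by exists 0; exact: subset_closure.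
exists (p - q).
  by apply: contra_notN clp; rewrite subr_eq0 => /eqP ->.
move=> d Dd; rewrite mxE.
set a := \sum_j _; pose b := \sum_j d 0 j ^+ 2.
have b0 : 0 <= b by apply: sumr_ge0 => j _; exact: sqr_ge0.
have key s : 0 < s -> 0 <= s * b - 2 * a.
  move=> s0.
  have := qmin _ (closure_cone_add coneD clq (DZ _ _ (ltW s0) Dd)).
  have -> : sqdist p (q + s *: d) = sqdist p q + s * (s * b - 2 * a).
    rewrite /sqdist mulrBr mulrCA !mulr_sumr -sumrB -big_split /=.
    by apply: eq_bigr => j _; rewrite !mxE; ring.
  by rewrite lerDl pmulr_rge0.
rewrite leNgt; apply/negP => a0.
have b1 : 0 < b + 1 by rewrite ltr_wpDl.
have /key : 0 < a / (b + 1) by rewrite divr_gt0.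
have : a / (b + 1) * b <= a by rewrite mulrAC ler_pdivrMr// ler_pM2l// lerDl.
lra.
Qed.

End RowVectors.

(** The version for abstract vector spaces, obtained in coordinates; it is
    needed for Y x R, which carries the sup norm. *)
Lemma cone_separation (R : realType) (V : vectType R) (D : set V) :
  convex_cone D -> D <> setT ->
  exists2 phi : {linear V -> R^o},
    (exists v, phi v != 0) & forall d, D d -> phi d <= 0.
Proof.
move=> [D0 DD DZ] DT.
have [u Du] : exists u, ~ D u.
  apply: contrapT => /forallNP DA; apply: DT.
  by apply/seteqP; split => // v _; apply: contrapT; exact: DA.
have coneD' : convex_cone (r2v @^-1` D).
  split => /= [|v w Dv Dw|t v t0 Dv]; first by rewrite linear0.
    by rewrite linearD; exact: DD.
  by rewrite linearZ; exact: DZ.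
have [|w w0 wD] := cone_separation_row (u := v2r u) coneD'.
  by rewrite /= v2rK.
pose g (v : V) : R^o := (v2r v *m w^T) 0 0.
have glin : linear g.
  by move=> a x y; rewrite /g linearP mulmxDl -scalemxAl !mxE.
exists (HB.pack g (GRing.isLinear.Build _ _ _ _ g glin) : {linear V -> R^o}).
  have [j wj] : exists j, w 0 j != 0 by apply/rV0Pn.
  exists (r2v (delta_mx 0 j)) => /=.
  by rewrite /g r2vK -rowE !mxE.
by move=> d Dd; apply: wD; rewrite /= v2rK.
Qed.

(** * Topology of finite-dimensional Hilbert spaces *)

Section Hilbert.
Context {R : realType} {X : finHilbertType R}.
Implicit Types (u v w x : X).

Lemma innerNl u v : inner (- u) v = - inner u v.
Proof. by rewrite -scaleN1r innerZl mulN1r. Qed.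

Lemma innerBl u v w : inner (u - v) w = inner u w - inner v w.
Proof. by rewrite innerDl innerNl. Qed.

Lemma innerBr u v w : inner w (u - v) = inner w u - inner w v.
Proof. by rewrite innerC innerBl !(innerC w). Qed.

Lemma inner0l v : inner 0 v = 0.
Proof. by rewrite -(scale0r v) innerZl mul0r. Qed.

Lemma inner0r v : inner v 0 = 0.
Proof. by rewrite innerC inner0l. Qed.

Lemma inner_self_le0 v : inner v v <= 0 -> v = 0.
Proof.
by rewrite inner_norm real_exprn_even_le0//= => /eqP/normr0_eq0.
Qed.

Lemma normD_sqr u v : `|u + v| ^+ 2 = `|u| ^+ 2 + 2 * inner u v + `|v| ^+ 2.
Proof. by rewrite -!inner_norm innerDl !innerDr (innerC v u); ring. Qed.

Lemma inner_polarization u v :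
  inner u v = (`|u + v| ^+ 2 - `|u| ^+ 2 - `|v| ^+ 2) / 2.
Proof. by rewrite normD_sqr; field. Qed.

Lemma cauchy_schwarz u v : inner u v <= `|u| * `|v|.
Proof.
have : `|u + v| ^+ 2 <= (`|u| + `|v|) ^+ 2.
  by rewrite ler_pXn2r ?nnegrE ?addr_ge0// ler_normD.
rewrite normD_sqr sqrrD mulr_natl; lra.
Qed.

Lemma inner_continuous v : continuous (fun u : X => inner u v : R).
Proof.
under eq_fun do rewrite inner_polarization.
move=> u; apply: cvgMr_tmp; apply: cvgB; last exact: cvg_cst.
have sqr_cvg (g : X -> X) : g @ u --> g u ->
    (fun x => `|g x| ^+ 2 : R) @ u --> `|g u| ^+ 2.
  by move=> cg; exact: cvgM (cvg_norm cg) (cvg_norm cg).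
by apply: cvgB; apply: sqr_cvg; [exact: cvgD cvg_id (cvg_cst _)|exact: cvg_id].
Qed.

Lemma closed_inner_le v (a : R) : closed [set u | inner u v <= a].
Proof.
apply: (preimage_closed (f := fun u => inner u v) _ (@closed_le _ a)) => u _.
exact: inner_continuous.
Qed.

(** Coordinates are linear forms, so by Riesz they are inner products with fixed
    vectors, and Cauchy-Schwarz bounds them. *)
Lemma v2r_bounded : exists2 C : R, 0 <= C & forall u, `|v2r u| <= C * `|u|.
Proof.
have coordE j : exists w, forall u, v2r u 0 j = inner u w.
  pose g (u : X) : R^o := v2r u 0 j.
  have glin : linear g by move=> a x y; rewrite /g linearP !mxE.
  exact: (riesz (HB.pack g (GRing.isLinear.Build _ _ _ _ g glin)
                 : {linear X -> R^o})).
have [w wE] := choice coordE.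
exists (\sum_j `|w j|); first exact: sumr_ge0.
move=> u; rewrite [leLHS]mx_normrE; apply/bigmax_leP; split => /=.
  by rewrite mulr_ge0// sumr_ge0.
move=> -[i j] _ /=; rewrite (ord1 i) wE.
apply: (@le_trans _ _ (`|w j| * `|u|)).
  rewrite mulrC; apply/ler_normlP; split; last exact: cauchy_schwarz.
  by rewrite -innerNl -(normrN u) cauchy_schwarz.
by rewrite ler_wpM2r// (bigD1 j)//= lerDl sumr_ge0.
Qed.

Lemma r2v_continuous : continuous (r2v : 'rV[R]_(dim X) -> X).
Proof.
have -> : (r2v : 'rV[R]_(dim X) -> X) =
    fun r => \sum_j r 0 j *: r2v (delta_mx 0 j).
  apply/funext => r; rewrite {1}[r]row_sum_delta linear_sum.
  by apply: eq_bigr => j _; rewrite linearZ.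
apply: continuous_big => [|j _ r]; first exact: add_continuous.
exact: cvgZr_tmp (@coord_continuous R 1 _ 0 j r).
Qed.

(** A ball is the image under the continuous map r2v of a closed set of
    coordinate vectors, which is bounded by the previous estimate. *)
Lemma compact_norm_ball x (rho : R) : compact [set y | `|y - x| <= rho].
Proof.
pose K := [set r : 'rV[R]_(dim X) | `|r2v r - x| <= rho].
have -> : [set y | `|y - x| <= rho] = r2v @` K.
  apply/seteqP; split => [y yx|_ [r rK <-]//].
  by exists (v2r y); rewrite /K /= v2rK.
apply: continuous_compact; first exact/continuous_subspaceT/r2v_continuous.
have [C C0 v2rC] := v2r_bounded.
apply: bounded_closed_compact.
  exists (C * (rho + `|x|)); split; first exact: num_real.
  move=> M ltM r rK; rewrite -(r2vK r); apply: le_trans (v2rC _) _.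
  apply: le_trans (ltW ltM); rewrite ler_wpM2l//.
  rewrite -[r2v r](subrK x); apply: le_trans (ler_normD _ _) _.
  by rewrite lerD2r.
rewrite /K; apply: (preimage_closed _ (@closed_le _ _)) => r _.
exact: cvg_norm (cvgB (@r2v_continuous r) (cvg_cst _)).
Qed.

End Hilbert.

(** * The horizon subdifferential of a convex function *)

Section Horizon.
Context {R : realType} {X : finHilbertType R}.
Implicit Types (h : X -> \bar R) (x y u v : X).

Definition normal_dom h x : set X :=
  [set v | forall y, dom h y -> inner v (y - x) <= 0].

Lemma dom_fin_num h x : proper_fun h -> dom h x -> h x \is a fin_num.
Proof. by move=> [hN _] dx; rewrite fin_numE hN lt_eqF. Qed.

(** Lower semicontinuity: (x, h x - eta) is off the closed set epi h, hence so
    are the nearby points (y, h x - eta). *)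
Lemma closed_fun_lsc h x (eta : R) : closed_fun h -> 0 < eta ->
  h x \is a fin_num -> \forall y \near x, ((fine (h x) - eta)%:E < h y)%E.
Proof.
move=> clh eta0 fx; set s := fine (h x) - eta.
have : nbhs ((x, s) : X * R^o) (~` epi h).
  apply: open_nbhs_nbhs; split; first exact: closed_openC.
  by move=> [_ /=]; rewrite -(fineK fx) lee_fin /s; lra.
have : ((fun y => (y, s) : X * R^o) @ x --> ((x, s) : X * R^o)).
  exact: cvg_pair cvg_id (cvg_cst _).
move=> /[apply]; rewrite /nbhs /=; apply: filterS => y /= epiNy.
rewrite ltNge; apply/negP => hy; apply: epiNy; split => //=.
exact: le_lt_trans hy (ltry _).
Qed.

(** The minimiser (y, r) of eps r + |y - x - v|^2 / 2 over the compact part of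
    the epigraph given by |y - x| <= rho and h x - 1 <= r <= h x.  Comparison
    with (x, h x), together with normality of v, keeps y inside the open ball
    of radius rho, so that minimality is a first-order condition at y. *)
Lemma proximal_subgradient h x v (rho eps : R) :
  proper_fun h -> closed_fun h -> dom h x -> normal_dom h x v ->
  0 < rho -> 0 < eps -> 2 * eps < rho ^+ 2 ->
  (forall y, `|y - x| <= rho -> ((fine (h x) - 1)%:E <= h y)%E) ->
  exists y u, [/\ regular_subdiff h y u, (h y <= h x)%E,
    `|y - x| ^+ 2 <= 2 * eps & eps *: u = v - (y - x)].
Proof.
move=> hp clh dx nv rho0 eps0 eps_rho hlow.
have fx := dom_fin_num hp dx; set a := fine (h x) in hlow *.
pose q y := `|y - x - v| ^+ 2 / 2.
have qE y : q y = `|y - x| ^+ 2 / 2 - inner v (y - x) + `|v| ^+ 2 / 2.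
  by rewrite /q normD_sqr normrN innerC innerNl; field.
have qv y : dom h y -> `|y - x| ^+ 2 / 2 + `|v| ^+ 2 / 2 <= q y.
  by move=> /nv; rewrite qE; lra.
have qx : q x = `|v| ^+ 2 / 2 by rewrite /q subrr sub0r normrN.
pose G : set (X * R^o) :=
  ([set y | `|y - x| <= rho] `*` `[a - 1, a]) `&` epi h.
have cG : compact G.
  apply: compact_closedI => //; apply: compact_setX.
    exact: compact_norm_ball.
  exact: segment_compact.
have Gx : G (x, a).
  split; split => //=; rewrite ?subrr ?normr0 ?(ltW rho0)//.
    by rewrite in_itv/=; lra.
  by rewrite fineK.
pose g (p : X * R^o) : R := eps * p.2 + q p.1.
have cg : continuous g.
  move=> p.
  have c1 : (fun p : X * R^o => p.1 - x - v) @ p --> p.1 - x - v.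
    exact: cvgB (cvgB cvg_fst (cvg_cst _)) (cvg_cst _).
  apply: cvgD; first exact: cvgM (cvg_cst _) cvg_snd.
  apply: cvgMr_tmp; exact: cvgM (cvg_norm c1) (cvg_norm c1).
have G0 : G !=set0 by exists (x, a).
have [[y r]] := compact_EVT_min G0 cG (continuous_subspaceT cg).
rewrite inE => -[[/= yrho]]; rewrite in_itv/= => /andP[ar ra] [/= dy hyr] gmin.
have fy := dom_fin_num hp dy.
have gx : g (y, r) <= eps * a + `|v| ^+ 2 / 2.
  by have := gmin (x, a); rewrite {2}/g /= qx; apply; rewrite inE.
have yx2 : `|y - x| ^+ 2 <= 2 * eps.
  have : eps * (a - r) <= eps * 1 by rewrite ler_pM2l//; lra.
  by move: gx (qv y dy); rewrite /g /=; lra.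
have yx : `|y - x| < rho.
  by rewrite -(ltr_pXn2r (n := 2)) ?nnegrE ?(ltW rho0)// (le_lt_trans yx2).
exists y, (eps^-1 *: (v - (y - x))); split => //; last first.
- by rewrite scalerA divff ?gt_eqF// scale1r.
- by apply: le_trans hyr _; rewrite -(fineK fx) lee_fin.
split=> // e e0.
near=> y'.
have [->|hy'] := eqVneq (h y') +oo%E; first by rewrite leey.
have dy' : dom h y' by rewrite /dom/= lt_neqAle hy' leey.
have fy' := dom_fin_num hp dy'.
have hyr' : fine (h y) <= r by rewrite -lee_fin fineK.
have y'rho : `|y' - x| <= rho.
  have -> : y' - x = (y' - y) + (y - x) by rewrite addrA subrK.
  apply: le_trans (ler_normD _ _) _; rewrite -lerBrDr ltW//.
  near: y'; apply/nbhs_normP; exists (rho - `|y - x|) => /=.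
    by rewrite subr_gt0.
  by move=> z /=; rewrite distrC.
(* points above the truncation level h x cannot do better than (x, h x) itself,
   since v is normal *)
have key : g (y, r) <= eps * fine (h y') + q y'.
  have [c|c] := leP (fine (h y')) a; last first.
    apply: le_trans gx _; apply: lerD; first by rewrite ler_pM2l// ltW.
    by apply: le_trans (qv _ dy'); rewrite lerDr divr_ge0// sqr_ge0.
  apply: (gmin (y', fine (h y'))); rewrite inE; split; split => //=.
    by rewrite in_itv/= c andbT -lee_fin fineK// hlow.
  by rewrite fineK.
rewrite -(fineK fy) -(fineK fy') -EFinD lee_fin innerZl.
have small : `|y' - y| <= 2 * eps * e.
  near: y'; apply/nbhs_normP; exists (2 * eps * e) => /=.
    by rewrite !mulr_gt0.
  by move=> z /=; rewrite distrC => /ltW.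
have qy' : q y' = q y - inner (v - (y - x)) (y' - y) + `|y' - y| ^+ 2 / 2.
  rewrite {1}/q.
  have <- : (y - x - v) + (y' - y) = y' - x - v by rewrite addrC !addrA subrK.
  by rewrite normD_sqr -[v - (y - x)]opprB innerNl /q; field.
rewrite -(ler_pM2l eps0) mulrDr mulrBr !mulrA divff ?gt_eqF// mul1r.
move: key; rewrite /g /= qy'.
have : eps * fine (h y) <= eps * r by rewrite ler_pM2l.
have : `|y' - y| * `|y' - y| <= (2 * eps * e) * `|y' - y|.
  by rewrite ler_wpM2r.
rewrite expr2; lra.
Unshelve. all: by end_near.
Qed.

(** For the first inclusion, multiply the subgradient inequality at x_k by t_k:
    the values of h disappear in the limit.  For the second, take the proximal
    subgradients with eps = t_k -> 0; the values at the proximal points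
    converge because h y_k <= h x and h is lower semicontinuous. *)
Lemma horizon_subdiff_normal_dom h x :
  proper_fun h -> closed_fun h -> convex_fun h -> dom h x ->
  horizon_subdiff h x = normal_dom h x.
Proof.
move=> hp clh ch dx; have fx := dom_fin_num hp dx.
apply/seteqP; split => v /=.
  move=> [-> y _|]; first by rewrite inner0l.
  move=> [x_ [v_ [t_ [[cx chx] hv t0 ct cv]]]] y dy.
  have fy := dom_fin_num hp dy.
  have chf : (fun k => fine (h (x_ k))) @ \oo --> fine (h x).
    by apply: fine_cvg; rewrite fineK.
  have ci : (fun k => inner (t_ k *: v_ k) (y - x_ k) -
      t_ k * (fine (h y) - fine (h (x_ k)))) @ \oo -->
      inner v (y - x) - 0 * (fine (h y) - fine (h x)).
    apply: cvgB; first exact: inner_cvg cv (cvgB (cvg_cst _) cx).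
    exact: cvgM ct (cvgB (cvg_cst _) chf).
  rewrite mul0r subr0 in ci.
  apply: (cvgr_to_le ci); near=> k.
  have := hv k; rewrite regular_subdiff_convex// => -[fk /(_ y)].
  rewrite -(fineK fk) -(fineK fy) -EFinD lee_fin /= => le.
  rewrite innerZl -mulrBr pmulr_rle0//; lra.
move=> nv; right.
have [r /= r0 hr] : exists2 r : R, 0 < r &
    forall y, `|y - x| <= r -> ((fine (h x) - 1)%:E <= h y)%E.
  have /nbhs_normP[r r0 hr] := closed_fun_lsc clh ltr01 fx.
  exists (r / 2) => [|y yr]; first by rewrite divr_gt0.
  apply/ltW/hr => /=; rewrite distrC; apply: le_lt_trans yr _.
  by rewrite gtr_pMr// invf_lt1// ltr1n.
pose t_ k : R := r ^+ 2 / 4 * k.+1%:R^-1.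
have r2 : 0 < r ^+ 2 / 4 by rewrite divr_gt0// exprn_gt0.
have t0 k : 0 < t_ k by rewrite mulr_gt0// invr_gt0 ltr0n.
have ct : t_ @ \oo --> (0 : R).
  rewrite -(mulr0 (r ^+ 2 / 4)).
  exact: cvgM (cvg_cst _) cvg_harmonic.
have tr k : 2 * t_ k < r ^+ 2.
  have : t_ k <= r ^+ 2 / 4.
    by rewrite /t_ ger_pMr// invf_le1 ?ler1n// ltr0n.
  lra.
have /choice[x_ /choice[v_ H]] k :=
  proximal_subgradient hp clh dx nv r0 (t0 k) (tr k) hr.
have cx : x_ @ \oo --> x.
  apply/cvgrPdist_lt => e e0.
  have : \forall k \near \oo, t_ k < e ^+ 2 / 2.
    apply: (cvgr_lt _ ct); by rewrite divr_gt0// exprn_gt0.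
  apply: filterS => k tk; have [_ _ xk _] := H k.
  rewrite distrC -(ltr_pXn2r (n := 2)) ?nnegrE ?(ltW e0)//.
  by apply: le_lt_trans xk _; lra.
exists x_, v_, t_; split => //.
- split => //.
  have fxk k : h (x_ k) \is a fin_num by have [[]] := H k.
  rewrite -(fineK fx); apply/fine_cvgP; split; first by near=> k; exact: fxk.
  apply/cvgrPdist_le => e e0.
  have : \forall k \near \oo, ((fine (h x) - e)%:E < h (x_ k))%E.
    exact: cx _ (closed_fun_lsc clh e0 fx).
  apply: filterS => k /=; have [_ hk _ _] := H k.
  rewrite -(fineK (fxk k)) lte_fin => lo.
  have le : fine (h (x_ k)) <= fine (h x) by rewrite -lee_fin !fineK.
  by rewrite ger0_norm ?subr_ge0// lerBlDr -lerBlDl ltW.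
- by move=> k; have [] := H k.
- have -> : (fun k => t_ k *: v_ k) = (fun k => v - (x_ k - x)).
    by apply/funext => k; have [] := H k.
  rewrite -[X in _ --> X]subr0 -(subrr x).
  exact: cvgB (cvg_cst _) (cvgB cx (cvg_cst _)).
Unshelve. all: by end_near.
Qed.

End Horizon.

(** * Epigraphical normal cones *)

Section Epigraph.
Context {R : realType} {X : finHilbertType R}.
Implicit Types (h : X -> \bar R) (x y v : X).

Lemma epi_fine h x : proper_fun h -> dom h x -> epi h (x, fine (h x)).
Proof. by move=> hp dx; split => //=; rewrite fineK// dom_fin_num. Qed.

Lemma normal_epi_dom h x v : proper_fun h -> dom h x ->
  normal_cone (epi h) (x, fine (h x)) (v, 0) <-> normal_dom h x v.
Proof.
move=> hp dx; split => [[_ nv] y dy|nv].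
  by have := nv _ (epi_fine hp dy); rewrite /= mul0r addr0.
by split => [|[y r] [/= dy _]]; [exact: epi_fine|rewrite mul0r addr0 nv].
Qed.

Lemma normal_epi_subdiff h x v : proper_fun h -> dom h x ->
  normal_cone (epi h) (x, fine (h x)) (v, -1) <-> subdiff h x v.
Proof.
move=> hp dx; have fx := dom_fin_num hp dx; split => [[_ nv]|[_ sv]].
  split=> // y; have [->|hy] := eqVneq (h y) +oo%E; first by rewrite leey.
  have dy : dom h y by rewrite /dom/= lt_neqAle hy leey.
  have := nv _ (epi_fine hp dy); rewrite /= -(fineK fx).
  by rewrite -(fineK (dom_fin_num hp dy)) -EFinD lee_fin /=; lra.
split => [|[y r] [/= dy hyr]]; first exact: epi_fine.
have := le_trans (sv y) hyr; rewrite -(fineK fx) -EFinD lee_fin /=; lra.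
Qed.

Lemma normal_coneZ (S : set (X * R^o)) (z w : X * R^o) (c : R) : 0 < c ->
  normal_cone S z (c *: w.1, c * w.2) <-> normal_cone S z w.
Proof.
by move=> c0; split => -[Sz nw]; split => // p /nw /=;
  rewrite innerZl -mulrA -mulrDr pmulr_rle0.
Qed.

Lemma normal_epi_le0 h x v (s : R) : proper_fun h -> dom h x ->
  normal_cone (epi h) (x, fine (h x)) (v, s) -> s <= 0.
Proof.
move=> hp dx [_ /(_ (x, fine (h x) + 1))] /=.
rewrite subrr inner0r add0r addrAC subrr add0r mulr1; apply.
by split=> //=; rewrite EFinD (fineK (dom_fin_num hp dx)) leeDl// lee_fin.
Qed.

Lemma convex_epi h (p q : X * R^o) (t : R) : convex_fun h -> 0 <= t <= 1 ->
  epi h p -> epi h q -> epi h (t *: p + (1 - t) *: q).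
Proof.
move=> ch t01 [_ hp] [_ hq].
have /andP[t0 t1] := t01.
have le : (h (t *: p.1 + (1 - t) *: q.1)%R <=
    (t * (p.2 : R) + (1 - t) * (q.2 : R))%R%:E)%E.
  apply: le_trans (ch p.1 q.1 t t01) _; rewrite [leRHS]EFinD !EFinM.
  by apply: leeD; apply: lee_wpmul2l => //; rewrite lee_fin ?subr_ge0.
by split => //=; exact: le_lt_trans le (ltry _).
Qed.

Lemma tangent_dirs_dom h x y (t : R) : proper_fun h -> dom h x -> dom h y ->
  0 <= t -> tangent_dirs h x (t *: (y - x)).
Proof.
move=> hp dx dy t0; exists (t * (fine (h y) - fine (h x))).
apply: subset_closure; exists t, (y, fine (h y)); split => //.
exact: epi_fine.
Qed.

Lemma tangent_dirs_normal h x u v : proper_fun h -> dom h x ->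
  tangent_dirs h x u -> normal_dom h x v -> inner u v <= 0.
Proof.
move=> hp dx [r tur] nv.
have cl : closed [set p : X * R^o | inner p.1 v <= 0].
  apply: (preimage_closed (f := fst) _ (closed_inner_le (a := 0))) => p _.
  exact: cvg_fst.
have /closure_id cE := cl.
suff : tangent_cone (epi h) (x, fine (h x)) `<=`
    [set p : X * R^o | inner p.1 v <= 0] by move=> /(_ _ tur).
rewrite cE; apply: closureS => _ [t [[y s] [t0 [/= dy _] ->]]] /=.
by rewrite innerZl innerC mulr_ge0_le0// nv.
Qed.

End Epigraph.

Definition conic_hull (R : realType) (V : lmodType R) (S : set V) : set V :=
  [set w | exists t p, [/\ 0 <= t :> R, S p & w = t *: p]].

(** For t + s > 0, t u + s v is t + s times a convex combination of u and v. *)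
Lemma convex_conic_hull (R : realType) (V : lmodType R) (S : set V) :
  S !=set0 -> (forall (t : R) u v, 0 <= t <= 1 -> S u -> S v ->
    S (t *: u + (1 - t) *: v)) -> convex_cone (conic_hull S).
Proof.
move=> [s0 Ss0] cS; split.
- by exists 0, s0; rewrite scale0r.
- move=> _ _ [t [u [t0 Su ->]]] [s [v [s_ge0 Sv ->]]].
  have [ts0|ts] := eqVneq (t + s) 0.
    have -> : t = 0 by lra.
    have -> : s = 0 by lra.
    by exists 0, s0; rewrite !scale0r addr0.
  have ts_gt0 : 0 < t + s by rewrite lt_neqAle eq_sym ts addr_ge0.
  exists (t + s), ((t / (t + s)) *: u + (1 - t / (t + s)) *: v).
  split; first exact: ltW.
    apply: cS => //; apply/andP; split; first by rewrite divr_ge0// ltW.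
    by rewrite ler_pdivrMr// mul1r lerDl.
  rewrite scalerDr !scalerA; congr (_ *: _ + _ *: _); field => //.
- move=> t _ t0 [s [p [s0' Sp ->]]]; exists (t * s), p.
  by split; [exact: mulr_ge0| |rewrite scalerA].
Qed.

(** A Minkowski sum seen from its second factor: with B a space of multipliers,
    membership means that some multiplier brings v back into A. *)
Lemma set_sumP (V : zmodType) (S A B : set V) :
  S = [set u + w | u in A & w in B] <->
  forall v, S v <-> exists2 w, B w & A (v - w).
Proof.
split=> [-> v|SE]; first split.
- by move=> [u Au [w Bw <-]]; exists w; rewrite ?addrK.
- by move=> [w Bw Aw]; exists (v - w) => //; exists w; rewrite ?subrK.
apply/seteqP; split => [v /SE[w Bw Aw]|_ [u Au [w Bw <-]]].
  by exists (v - w) => //; exists w; rewrite ?subrK.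
by apply/SE; exists w; rewrite ?addrK.
Qed.

Lemma setI_eq0P (V : zmodType) (A B : set V) : A 0 -> B 0 ->
  A `&` B = [set 0] <-> forall v, A v -> B v -> v = 0.
Proof.
move=> A0 B0; split=> [AB v Av Bv|AB].
  by have : [set 0] v by rewrite -AB.
by apply/seteqP; split => [v [Av Bv]|_ ->//]; exact: AB.
Qed.

(** * The affine constraint *)

Section Constraint.
Context {R : realType} {X Y : finHilbertType R}.
Variables (A : {linear X -> Y}) (b : Y).
Hypothesis A_surj : forall y, exists x, A x = y.
Implicit Types (f : X -> \bar R) (x u v w : X).

(** The range of the adjoint is the orthogonal of ker A.  If w is orthogonal to
    ker A, then y |-> <B y, w> is linear for any section B of A, even though B
    itself is only chosen pointwise; the Riesz vector of this form is a
    preimage of w. *)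
Lemma adjoint_rangeP w :
  adjoint_range A w <-> forall u, A u = 0 -> inner u w = 0.
Proof.
split=> [[y _ <-] u Au|kerw]; first by rewrite -adjointE Au inner0l.
have [B AB] := choice A_surj.
pose g y : R^o := inner (B y) w.
have AE u u' : A u = A u' -> inner u w = inner u' w.
  move=> e; apply/eqP; rewrite -subr_eq0 -innerBl kerw//.
  by rewrite linearB e subrr.
have glin : linear g.
  move=> a y y'; rewrite /g (AE _ (a *: B y + B y')) ?innerDl ?innerZl//.
  by rewrite linearP !AB.
have [y gy] := riesz (HB.pack g (GRing.isLinear.Build _ _ _ _ g glin)
  : {linear Y -> R^o}).
exists y => //; apply/eqP; rewrite -subr_eq0; apply/eqP/inner_self_le0.
rewrite innerBr -adjointE -gy /= /g (AE _ (adjoint A y - w)) ?AB//.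
by rewrite subrr.
Qed.

Lemma adjoint_range0 : adjoint_range A 0.
Proof. by apply/adjoint_rangeP => u _; rewrite inner0r. Qed.

Lemma adjoint_rangeZ (c : R) w : adjoint_range A w -> adjoint_range A (c *: w).
Proof.
move=> /adjoint_rangeP Aw; apply/adjoint_rangeP => u /Aw.
by rewrite innerZr => ->; rewrite mulr0.
Qed.

Lemma adjoint_eq0 y : adjoint A y = 0 -> y = 0.
Proof.
have [u Au] := A_surj y => Ay; apply: inner_self_le0.
by rewrite -{1}Au adjointE Ay inner0r.
Qed.

(** Each y gives the closed condition <u, adjoint y> <= 0, that is
    <A u, y> <= 0; taking y = A u shows that together they say A u = 0. *)
Lemma closed_kernel : closed (lin_kernel A).
Proof.
have -> : lin_kernel A =
    \bigcap_(y in setT) [set u | inner u (adjoint A y) <= 0].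
  apply/seteqP; split => u /= Au.
    by move=> y _ /=; rewrite -adjointE Au inner0l.
  by apply: inner_self_le0; rewrite adjointE; exact: Au.
by apply: closed_bigI => y _; exact: closed_inner_le.
Qed.

Lemma closed_fiberR : closed (fiberR A b).
Proof.
have [x0 Ax0] := A_surj b.
have -> : fiberR A b = (fun p : X * R^o => p.1 - x0) @^-1` lin_kernel A.
  apply/seteqP; split => -[x r]; rewrite /fiberR /fiber /lin_kernel /=.
    by move=> [Ax _]; rewrite linearB Ax Ax0 subrr.
  by rewrite linearB Ax0 => /subr0_eq.
apply: (preimage_closed _ closed_kernel) => p _.
exact: cvgB cvg_fst (cvg_cst _).
Qed.

Lemma normal_fiberR x (r : R) : A x = b ->
  normal_cone (fiberR A b) (x, r) =
  [set w : X * R^o | adjoint_range A w.1 /\ w.2 = 0].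
Proof.
move=> Ax; apply/seteqP; split => -[w s] /=.
  move=> [_ nw]; split.
    apply/adjoint_rangeP => u Au; apply/eqP.
    have h1 : fiberR A b (x + u, r).
      by split => //; rewrite /fiber/= linearD Ax Au addr0.
    have h2 : fiberR A b (x - u, r).
      by split => //; rewrite /fiber/= linearB Ax Au subr0.
    move: (nw _ h1) (nw _ h2); rewrite /= !subrr !mulr0 !addr0.
    rewrite ![x + _ - x]addrAC !subrr !add0r (innerC w (- u)) innerNl.
    by rewrite (innerC w); lra.
  have h1 : fiberR A b (x, r + 1) by split.
  have h2 : fiberR A b (x, r - 1) by split.
  by move: (nw _ h1) (nw _ h2); rewrite /= !subrr !inner0r; lra.
move=> [/adjoint_rangeP Aw ->]; split => [|[y t] [/= Ay _]]; first by split.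
by rewrite mul0r addr0 innerC Aw// linearB Ay Ax subrr.
Qed.

Lemma tangent_fiberR x (r : R) : A x = b ->
  tangent_cone (fiberR A b) (x, r) = [set w : X * R^o | lin_kernel A w.1].
Proof.
move=> Ax; apply/seteqP; split => [|[u s] /= Au]; last first.
  apply: subset_closure; exists 1, (x + u, r + s); split => //.
    by split=> //; rewrite /fiber/= linearD Ax Au addr0.
  rewrite scale1r; congr pair => /=.
    by rewrite addrAC subrr add0r.
  by rewrite addrAC subrr add0r.
have cl : closed [set w : X * R^o | lin_kernel A w.1].
  apply: (preimage_closed (f := fst) _ closed_kernel) => p _; exact: cvg_fst.
have /closure_id -> := cl.
apply: closureS => _ [t [[y s] [t0 [/= Ay _] ->]]].
by rewrite /lin_kernel/= linearZ/= linearB Ay Ax subrr scaler0.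
Qed.

Lemma restr_fun_fiber f x : A x = b -> restr_fun f A b x = f x.
Proof. by move=> Ax; rewrite /restr_fun /indicator mem_set// adde0. Qed.

Lemma restr_fun_out f x : proper_fun f -> A x <> b ->
  restr_fun f A b x = +oo%E.
Proof.
by move=> [fN _] Ax; rewrite /restr_fun /indicator memNset// addey.
Qed.

Lemma dom_restr f x : proper_fun f ->
  dom (restr_fun f A b) x <-> dom f x /\ A x = b.
Proof.
move=> fp; rewrite /dom /=; have [Ax|Ax] := pselect (A x = b).
  by rewrite restr_fun_fiber//; split=> [|[]].
by rewrite restr_fun_out//; split => // -[].
Qed.

Lemma epi_restr f : proper_fun f ->
  epi (restr_fun f A b) = epi f `&` fiberR A b.
Proof.
move=> fp; apply/seteqP; split => [[x r] [/= /dom_restr[// | dx Ax]]|].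
  by rewrite restr_fun_fiber.
move=> [x r] [[/= dx fxr] [/= Ax _]]; split => /=; first exact/dom_restr.
by rewrite restr_fun_fiber.
Qed.

Lemma proper_restr f x : proper_fun f -> dom f x -> A x = b ->
  proper_fun (restr_fun f A b).
Proof.
move=> fp dx Ax; split; last by exists x; exact/dom_restr.
move=> y; have [Ay|Ay] := pselect (A y = b); last by rewrite restr_fun_out.
by rewrite restr_fun_fiber//; exact: fp.1.
Qed.

Lemma closed_restr f : proper_fun f -> closed_fun f ->
  closed_fun (restr_fun f A b).
Proof.
move=> fp clf; rewrite /closed_fun epi_restr//.
exact: closedI clf closed_fiberR.
Qed.

(** The cases t = 0 and t = 1 are treated apart because 0 * +oo = 0: the weight
    of a point outside the fiber vanishes there. *)
Lemma convex_restr f : proper_fun f -> convex_fun f ->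
  convex_fun (restr_fun f A b).
Proof.
move=> fp cf u v t /andP[]; rewrite le_eqVlt => /predU1P[<- _|t0].
  by rewrite scale0r add0r subr0 scale1r mul0e add0e mul1e.
rewrite le_eqVlt => /predU1P[->|t1].
  by rewrite scale1r subrr scale0r addr0 mul1e mul0e adde0.
have s0 : 0 < 1 - t by rewrite subr_gt0.
have rN y : restr_fun f A b y != -oo%E.
  have [Ay|Ay] := pselect (A y = b); last by rewrite restr_fun_out.
  by rewrite restr_fun_fiber//; exact: fp.1.
have mN (c : R) y : 0 < c -> (c%:E * restr_fun f A b y)%E != -oo%E.
  move=> c0; case: (restr_fun f A b y) (rN y) => [r| |]// _.
  by rewrite gt0_muley.
have [Au|Au] := pselect (A u = b); last first.
  by rewrite (restr_fun_out _ Au)// gt0_muley ?lte_fin// addye ?leey// mN.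
have [Av|Av] := pselect (A v = b); last first.
  rewrite (restr_fun_out _ Av)//.
  by rewrite (gt0_muley (x := (1 - t)%:E)) ?lte_fin// addey ?leey// mN.
rewrite !restr_fun_fiber//; first by apply: cf; rewrite !ltW.
by rewrite linearD !linearZ Au Av /= -scalerDl addrC subrK scale1r.
Qed.

End Constraint.

(** * Qualification conditions and sum rules *)

Section Conditions.
Context {R : realType} {X Y : finHilbertType R}.
Variables (A : {linear X -> Y}) (b : Y) (f : X -> \bar R) (x : X).
Hypothesis A_surj : forall y, exists u, A u = y.
Hypotheses (fp : proper_fun f) (clf : closed_fun f) (cf : convex_fun f).
Hypotheses (dx : dom f x) (Ax : A x = b).

Local Notation L := (adjoint_range A).
Local Notation a := (fine (f x)).

Lemma sub_pair0 (v w : X) (s : R) :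
  ((v, s) : X * R^o) - (w, 0) = (v - w, s).
Proof. by congr pair; rewrite /= subr0. Qed.

Lemma horizon_qualificationP :
  horizon_qualification f A x <->
  forall v, normal_dom f x v -> L v -> v = 0.
Proof.
rewrite /horizon_qualification horizon_subdiff_normal_dom//.
apply: setI_eq0P; last exact: adjoint_range0.
by move=> y _; rewrite inner0l.
Qed.

Lemma epi_transversality_horizon :
  epi_transversality f A b x <-> horizon_qualification f A x.
Proof.
rewrite horizon_qualificationP /epi_transversality normal_fiberR//.
have N0 : normal_cone (epi f) (x, a) 0.
  by apply/(normal_epi_dom 0 fp dx) => y _; rewrite inner0l.
rewrite setI_eq0P//; last by split => //; exact: adjoint_range0.
split=> [H v nv Lv|H [v s] nv [/= Lv s0]].
  have /(congr1 fst) // : (v, 0) = 0 :> X * R^o.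
  by apply: H => //; exact/normal_epi_dom.
by rewrite s0 in nv *; rewrite (H v)//; exact/(normal_epi_dom _ fp dx).
Qed.

(** Decompose a bad vector w as tangent + kernel: w has nonpositive product with
    the first part and is orthogonal to the second, so <w, w> <= 0. *)
Lemma robinson_CQ_horizon : robinson_CQ f A x -> horizon_qualification f A x.
Proof.
move=> rob; apply/horizon_qualificationP => w nw /(adjoint_rangeP A_surj) Lw.
have [u tu [k Ak ukw]] : [set u + w | u in tangent_dirs f x &
    w in lin_kernel A] w by rewrite rob.
apply: inner_self_le0; rewrite -{1}ukw innerDl (Lw k)// addr0.
exact: tangent_dirs_normal tu nw.
Qed.

(** The cone generated by (dom f - x) + ker A already has to be everything; it
    is contained in T_f(x) + ker A, which involves a closure. *)
Lemma horizon_robinson_CQ : horizon_qualification f A x -> robinson_CQ f A x.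
Proof.
move=> /horizon_qualificationP hq.
pose S := [set y - x + k | y in dom f & k in lin_kernel A].
have coneD : convex_cone (conic_hull S).
  apply: convex_conic_hull.
    exists 0, x => //; exists 0; first by rewrite /lin_kernel/= linear0.
    by rewrite subrr addr0.
  move=> t _ _ t01 [y dy [k Ak <-]] [y' dy' [k' Ak' <-]].
  exists (t *: y + (1 - t) *: y').
    by have [] := convex_epi cf t01 (epi_fine fp dy) (epi_fine fp dy').
  exists (t *: k + (1 - t) *: k').
    by rewrite /lin_kernel/= linearD !linearZ Ak Ak' /= !scaler0 addr0.
  rewrite !scalerDr [RHS]addrACA [in RHS](addrACA (t *: y)) -scalerDl.
  by rewrite [t + _]addrC subrK scale1r.
have DT : conic_hull S = setT.
  apply: contrapT => /(cone_separation coneD)[phi [v phiv] phiD].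
  have [w phiE] := riesz phi; have Sw u : S u -> inner u w <= 0.
    by move=> Su; rewrite -phiE; apply: phiD; exists 1, u; rewrite scale1r.
  have w0 : w = 0.
    apply: hq => [y dy|].
      rewrite innerC; apply: Sw; exists y => //; exists 0; rewrite ?addr0//.
      by rewrite /lin_kernel/= linear0.
    apply/(adjoint_rangeP A_surj) => k Ak; apply/eqP; rewrite eq_le.
    have Sk k' : A k' = 0 -> S k'.
      by move=> Ak'; exists x => //; exists k' => //; rewrite subrr add0r.
    rewrite Sw/=; last exact: Sk.
    by rewrite -oppr_le0 -innerNl Sw//; apply: Sk; rewrite linearN Ak oppr0.
  by move: phiv; rewrite phiE w0 inner0r eqxx.
apply/seteqP; split => // v _.
have [t [_ [t0 [y dy [k Ak <-]] ->]]] : conic_hull S v by rewrite DT.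
exists (t *: (y - x)); first exact: tangent_dirs_dom.
exists (t *: k); last by rewrite [RHS]scalerDr.
by rewrite /lin_kernel/= linearZ Ak /= scaler0.
Qed.

Lemma robinson_transversality_tangent :
  robinson_CQ f A x <-> epi_transversality_tangent f A b x.
Proof.
rewrite /epi_transversality_tangent tangent_fiberR//.
split=> H; apply/seteqP; split => //.
  move=> [v r] _.
  have [u [h tuh] [k Ak <-]] : [set u + w | u in tangent_dirs f x &
    w in lin_kernel A] v by rewrite H.
  exists (u, h) => //; exists (k, r - h) => //.
  by congr pair => /=; rewrite addrC subrK.
move=> v _.
have : [set: X * R^o] (v, 0) by [].
rewrite -H => -[[u h] tuh [[k s] /= Ak [<- _]]].
by exists u; [exists h|exists k].
Qed.

(** The Lagrange multiplier argument: val is the affine form given by the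
    restricted normal (v, s), which is nonpositive on the part of epi f over
    the fiber. *)
Lemma horizon_CHIP :
  horizon_qualification f A x -> epi_strong_CHIP f A b x.
Proof.
move=> /horizon_qualificationP hq.
rewrite /epi_strong_CHIP epi_restr// normal_fiberR//.
apply/set_sumP => -[v s].
split => [[_ nv]|[[w _] [/= Lw ->]] [ef nw]]; last first.
  split => [|[y r] [ey [/= Ay _]]]; first by split => //; exact: epi_fine.
  have := nw _ ey; rewrite /= subr0 innerBl.
  move/(adjoint_rangeP A_surj) : Lw => Lw.
  by rewrite (innerC w) Lw ?subr0// linearB Ay Ax subrr.
pose val (p : X * R^o) : R := inner v (p.1 - x) + s * (p.2 - a).
(* the inequality on the second component makes the weight rho of a separating
   form nonnegative *)
pose S : set (Y * R^o) :=
  [set q | exists2 p, epi f p & q.1 = A p.1 - b /\ q.2 <= val p].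
have coneP : convex_cone (conic_hull S).
  apply: convex_conic_hull.
    exists 0, (x, a); first exact: epi_fine.
    by rewrite /val /= Ax !subrr inner0r mulr0 addr0.
  move=> t [y r] [y' r'] t01 [p ep [/= -> rp]] [p' ep' [/= -> rp']].
  exists (t *: p + (1 - t) *: p'); first exact: convex_epi.
  split => /=.
    rewrite !scalerBr addrACA -opprD -scalerDl [t + _]addrC subrK scale1r.
    by rewrite [A (_ + _)]linearD ![A (_ *: _)]linearZ.
  have /andP[t0 t1] := t01.
  have : t * r <= t * val p by rewrite ler_wpM2l.
  have : (1 - t) * r' <= (1 - t) * val p' by rewrite ler_wpM2l ?subr_ge0.
  rewrite /val /= !innerBr innerDr !innerZr.
  rewrite /GRing.scale /=; lra.
(* over the fiber val is nonpositive, so the cone misses (0, 1) *)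
have PT : conic_hull S <> setT.
  move=> PT; have : [set: Y * R^o] (0, 1) by [].
  rewrite -PT => -[t [[y r] [t0 [p ep [/= Ap rp]] [ty tr]]]].
  have [t00|tN0] := eqVneq t 0; first by move: tr; rewrite t00 scale0r; lra.
  have y0 : y = 0.
    by move/esym/eqP : ty; rewrite scaler_eq0 (negbTE tN0)/= => /eqP.
  have : val p <= 0.
    by apply: nv; split => //; split => //; apply: subr0_eq; rewrite -Ap.
  have : t * r <= t * val p by rewrite ler_wpM2l.
  have : 1 = t * r by [].
  by nra.
have [phi [q0 phi0] phiP] := cone_separation coneP PT.
have phiS q : S q -> phi q <= 0.
  by move=> Sq; apply: phiP; exists 1, q; rewrite scale1r.
pose g (y : Y) : R^o := phi (y, 0).
have glin : linear g.
  move=> c y y'; rewrite /g -linearP; congr (phi _).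
  by congr pair; rewrite /= /GRing.scale /= mulr0 addr0.
have [mu gE] := riesz (HB.pack g (GRing.isLinear.Build _ _ _ _ g glin)
  : {linear Y -> R^o}).
pose rho : R := phi (0, 1).
have phiE (y : Y) (r : R) : phi (y, r) = inner y mu + r * rho.
  rewrite -gE /= /g /rho.
  have -> : (y, r) = (y, 0) + r *: ((0, 1) : Y * R^o).
    by congr pair; rewrite /= ?scaler0 ?addr0// add0r /GRing.scale /= mulr1.
  by rewrite linearD linearZ.
have key p (r : R) : epi f p -> r <= val p ->
    inner (A p.1 - b) mu + r * rho <= 0.
  by move=> ep rp; rewrite -phiE; apply: phiS; exists p.
have valx : val (x, a) = 0 by rewrite /val /= !subrr inner0r mulr0 addr0.
have rho0 : 0 <= rho.
  have := key (x, a) (-1) (epi_fine fp dx).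
  by rewrite valx /= Ax subrr inner0l lerN10 => /(_ isT); lra.
(* with rho = 0 the vector adjoint A mu would be normal to dom f *)
have rho_gt0 : 0 < rho.
  rewrite lt_neqAle rho0 andbT; apply/eqP => rhoE.
  have mu0 : mu = 0.
    apply: (adjoint_eq0 A_surj); apply: hq => [y dy|]; last by exists mu.
    have := key _ _ (epi_fine fp dy) (lexx _).
    rewrite /= -rhoE mulr0 addr0 [inner (adjoint _ _) _]innerC -adjointE.
    by rewrite linearB Ax.
  move: phi0; case: q0 => y r; rewrite phiE mu0 inner0r -rhoE mulr0 addr0.
  by rewrite eqxx.
exists (- rho^-1 *: adjoint A mu, 0).
  by split => //=; apply: adjoint_rangeZ => //; exists mu.
split => [|p ep]; first exact: epi_fine.
have := key p _ ep (lexx _).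
rewrite /= subr0 [inner (v - _) _]innerBl scaleNr innerNl opprK innerZl.
rewrite [inner (adjoint _ _) _]innerC -adjointE linearB Ax.
move=> le0.
apply: le_trans
  (_ : rho^-1 * (inner (A p.1 - b) mu + val p * rho) <= 0).
  rewrite le_eqVlt; apply/orP; left; apply/eqP.
  by rewrite /val; field; rewrite gt_eqF.
by rewrite mulr_ge0_le0// invr_ge0.
Qed.

Let fEp : proper_fun (restr_fun f A b).
Proof. exact: proper_restr dx Ax. Qed.

Let dEx : dom (restr_fun f A b) x.
Proof. exact/dom_restr. Qed.

Let aE : fine (restr_fun f A b x) = a.
Proof. by rewrite restr_fun_fiber. Qed.

(** Both sides compare normal cones fiber by fiber over the last coordinate s:
    s = 0 is the horizon rule, s < 0 rescales to s = -1, which is the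
    subdifferential rule, and for s > 0 both slices are empty. *)
Lemma CHIP_restricted_sum_rule :
  restricted_sum_rule f A b x <-> epi_strong_CHIP f A b x.
Proof.
rewrite /restricted_sum_rule /sum_rule /epi_strong_CHIP.
rewrite !horizon_subdiff_normal_dom//; first last.
- exact: convex_restr.
- exact: closed_restr.
rewrite !set_sumP normal_fiberR//.
split=> [[sr hr] [v s]|chip]; last first.
  split=> v.
    rewrite -normal_epi_subdiff// aE chip; split => [[[w t] [/= Lw ->]]|[w Lw]].
      by rewrite sub_pair0 => /(normal_epi_subdiff _ fp dx); exists w.
    move=> /(normal_epi_subdiff _ fp dx) nw; exists (w, 0) => //=.
    by rewrite sub_pair0; exact: nw.
  rewrite -normal_epi_dom// aE chip; split => [[[w t] [/= Lw ->]]|[w Lw]].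
    by rewrite sub_pair0 => /(normal_epi_dom _ fp dx); exists w.
  move=> /(normal_epi_dom _ fp dx) nw; exists (w, 0) => //=.
  by rewrite sub_pair0; exact: nw.
suff H : normal_cone (epi (restr_fun f A b)) (x, a) (v, s) <->
    exists2 w, L w & normal_cone (epi f) (x, a) (v - w, s).
  rewrite H; split => [[w Lw nw]|[[w t] [/= Lw ->]]].
    by exists (w, 0) => //=; rewrite sub_pair0.
  by rewrite sub_pair0; exists w.
have [s0|s0|->] := ltgtP s 0; last 1 first.
- rewrite -aE normal_epi_dom// hr aE.
  by split => -[w Lw] /normal_epi_dom nw; exists w => //; exact: nw.
- have c0 : 0 < (- s)^-1 by rewrite invr_gt0 oppr_gt0.
  have sc : (- s)^-1 * s = -1 by field; rewrite lt_eqF.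
  have scE (S : set (X * R^o)) (u : X) : normal_cone S (x, a) (u, s) <->
      normal_cone S (x, a) ((- s)^-1 *: u, -1).
    by rewrite -(normal_coneZ _ _ (u, s) c0) /= sc.
  rewrite scE -aE normal_epi_subdiff// sr aE.
  split => -[w Lw]; last first.
    move=> /scE; rewrite scalerBr => /(normal_epi_subdiff _ fp dx) nw.
    by exists ((- s)^-1 *: w) => //; exact: adjoint_rangeZ.
  move=> /(normal_epi_subdiff _ fp dx) nw; exists (- s *: w).
    exact: adjoint_rangeZ.
  apply/scE; rewrite scalerBr scalerA mulVf ?scale1r//.
  by rewrite oppr_eq0 lt_eqF.
- split=> [|[w _ /(normal_epi_le0 fp dx)]]; last by lra.
  by rewrite -aE => /(normal_epi_le0 fEp dEx); lra.
Qed.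

End Conditions.

(** S + ker A is the preimage of A(S). *)
Lemma sum_kernel_image (R : realType) (X Y : finHilbertType R)
    (A : {linear X -> Y}) (S : set X) : (forall y, exists u, A u = y) ->
  [set u + w | u in S & w in lin_kernel A] = setT <-> A @` S = setT.
Proof.
move=> A_surj; split => H; apply/seteqP; split => // v _.
  have [u <-] := A_surj v.
  have [s Ss [k Ak <-]] : [set u + w | u in S & w in lin_kernel A] u.
    by rewrite H.
  by exists s => //; rewrite linearD Ak addr0.
have [s Ss As] : (A @` S) (A v) by rewrite H.
exists s => //; exists (v - s); last by rewrite addrC subrK.
by rewrite /lin_kernel/= linearB As subrr.
Qed.

Lemma lin_sub (R : realType) (X : finHilbertType R) (S : set X) :
  lin S `<=` S.
Proof. by move=> v [W [WS vW]]; exact: WS. Qed.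

(** * The implications *)

Theorem proposition4 (R : realType) (X Y : finHilbertType R)
    (f : X -> \bar R) (A : {linear X -> Y}) (b : Y) :
  proper_fun f -> closed_fun f -> convex_fun f ->
  (forall y : Y, exists x : X, A x = y) ->
  feasible f A b !=set0 ->
  forall x : X, feasible f A b x ->
  [/\ epi_transversality f A b x <-> epi_transversality_tangent f A b x,
      robinson_CQ f A x <-> robinson_CQ_image f A x
    & robinson_nondegeneracy f A x <-> robinson_nondegeneracy_image f A x]
  /\
  [/\ robinson_nondegeneracy f A x -> robinson_CQ f A x,
      (epi_transversality f A b x <-> horizon_qualification f A x) /\
      (horizon_qualification f A x <-> robinson_CQ f A x),
      epi_transversality f A b x -> epi_strong_CHIP f A b x,
      restricted_sum_rule f A b x <-> epi_strong_CHIP f A b x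
    & restricted_sum_rule f A b x -> sum_rule f A b x].
Proof.
move=> fp clf cf A_surj _ x [Ax dx].
have tang := robinson_transversality_tangent f Ax.
have hr : horizon_qualification f A x <-> robinson_CQ f A x.
  split; first exact: horizon_robinson_CQ.
  exact: robinson_CQ_horizon.
have eh : epi_transversality f A b x <-> horizon_qualification f A x.
  exact: epi_transversality_horizon.
split; split; try exact: sum_kernel_image.
- by rewrite eh hr; exact: tang.
- move=> H; apply/seteqP; split => // v _.
  have [u /lin_sub tu [k Ak <-]] : [set u + w | u in lin (tangent_dirs f x) &
    w in lin_kernel A] v by rewrite H.
  by exists u => //; exists k.
- by [].
- by move=> /eh; exact: horizon_CHIP.
- exact: CHIP_restricted_sum_rule.
- by case.
Qed.
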